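(* For every integer $d\ge2$, let $c_d$ be the maximum constant such that every directed graph with $m$ edges and minimum outdegree at least $d$ admits a bipartition $V=V_1\cup V_2$ of its vertex set with $\min\{e(V_1,V_2),e(V_2,V_1)\}\ge c_d\cdot m$. Then $$c_d\le\frac{d-1}{2(2d-1)}.$$
   Context: A directed graph $D=(V,E)$ is a finite vertex set $V$ together with a set $E$ of distinct ordered pairs (edges) $\overrightarrow{uv}$ with $u\ne v$; no loops or multiple edges are allowed, but both $\overrightarrow{uv}$ and $\overrightarrow{vu}$ may be present. The minimum outdegree is the minimum over $v\in V$ of the number of out-neighbors of $v$. For $X,Y\subset V$, $e(X,Y)$ is the number of edges $\overrightarrow{xy}\in E$ with $x\in X$, $y\in Y$. A bipartition $V=V_1\cup V_2$ is a partition of $V$ into two disjoint sets. *)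

(* Defs.v *)
From mathcomp Require Import all_boot all_order all_algebra.
From mathcomp Require Import boolp classical_sets reals.
Set Implicit Arguments.
Unset Strict Implicit.
Unset Printing Implicit Defensive.
Import Order.TTheory GRing.Theory Num.Theory.
Local Open Scope ring_scope.

Record digraph := Digraph {
  vertex :> finType;
  edge : rel vertex;
  edge_irr : irreflexive edge }.

Section Digraph.
Variable D : digraph.

Definition num_edges : nat := #|[set p : D * D | edge p.1 p.2]|.

Definition outdegree (v : D) : nat := #|[set w | edge v w]|.

(* Every outdegree is smaller than #|D|, so the default value #|D| only
   matters when there is no vertex; the minimum is then 0. *)
Definition min_outdegree : nat := \big[minn/#|D|]_(v : D) outdegree v.

Definition edges_between (X Y : {set D}) : nat :=
  #|[set p : D * D | [&& p.1 \in X, p.2 \in Y & edge p.1 p.2]]|.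

Definition bipartition (V1 V2 : {set D}) : Prop :=
  V1 :|: V2 = [set: D] /\ V1 :&: V2 = finset.set0.

Lemma leq_min_outdegree (d : nat) : (0 < d)%N ->
  (d <= min_outdegree)%N <->
  (0 < #|D|)%N /\ (forall v : D, (d <= outdegree v)%N).
Proof.
move=> d0; rewrite /min_outdegree; split=> [h|[D0 h]].
  have hv v : (d <= outdegree v)%N.
    apply: leq_trans h _; have := mem_index_enum v.
    elim: (index_enum _) => // w s IH; rewrite inE big_cons geq_min.
    by case/predU1P => [->|/IH ->]; rewrite ?leqnn ?orbT.
  split=> //; rewrite lt0n; apply/negP => /eqP D0.
  move: h; rewrite big_pred0 => [|v]; last by have := fintype0 v D0.
  by rewrite D0 leqNgt d0.
elim/big_ind: _ => [|x y hx hy|v _]; last exact: h.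
  have /card_gt0P[v _] := D0.
  by apply: leq_trans (h v) _; exact: max_card.
by rewrite leq_min hx.
Qed.

End Digraph.

Definition admissible (R : realType) (d : nat) (c : R) : Prop :=
  forall D : digraph, (d <= min_outdegree D)%N ->
  exists V1 V2 : {set D}, bipartition V1 V2 /\
    (minn (edges_between V1 V2) (edges_between V2 V1))%:R
      >= c * (num_edges D)%:R.

Definition max_admissible (R : realType) (d : nat) (c : R) : Prop :=
  admissible d c /\ (forall c' : R, admissible d c' -> c' <= c).

Lemma admissible0 (R : realType) (d : nat) : admissible d (0 : R).
Proof.
move=> D _; exists [set: D], finset.set0.
by split; [split; rewrite ?finset.setU0 ?finset.setI0|rewrite mul0r ler0n].
Qed.

Lemma admissible_le1 (R : realType) (d : nat) (c : R) :
  (0 < d)%N -> admissible d c -> c <= 1.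
Proof.
move=> d0 hc.
have irr : irreflexive (fun x y : 'I_d.+1 => x != y) by move=> x; rewrite eqxx.
pose K := @Digraph 'I_d.+1 _ irr.
have hK : (d <= min_outdegree K)%N.
  apply/(leq_min_outdegree K d0); split=> [|v]; first by rewrite card_ord.
  rewrite /outdegree /= (_ : [set w | v != w] = [set~ v])%SET.
    by rewrite cardsC1 card_ord.
  by apply/finset.setP => w; rewrite !inE eq_sym.
have [V1 [V2 [_ h]]] := hc K hK.
have m0 : (0 < num_edges K)%N.
  apply/card_gt0P; exists (ord0, ord_max); rewrite inE /=.
  by rewrite -val_eqE /= eq_sym -lt0n.
rewrite -(ler_pM2r (x := (num_edges K)%:R)) ?ltr0n // mul1r.
apply: le_trans h _; rewrite ler_nat.
apply: leq_trans (geq_minl _ _) _; apply/subset_leq_card/fintype.subsetP => p.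
by rewrite !inE => /and3P[].
Qed.

(* The maximum constant exists; it is unique by antisymmetry. *)
Lemma max_admissible_exists (R : realType) (d : nat) :
  (0 < d)%N -> exists c : R, max_admissible d c.
Proof.
move=> d0; pose S : classical_sets.set R := [set c | admissible d c]%classic.
have S0 : (S !=set0)%classic by exists 0; exact: admissible0.
have ubS : has_ubound S by exists 1 => c; exact: admissible_le1.
exists (sup S); split=> [D hD|c hc]; last exact: ub_le_sup.
pose F (A : {set D}) := minn (edges_between A (~: A)) (edges_between (~: A) A).
have [A _ hA] := @arg_maxnP _ finset.set0 predT F isT.
exists A, (~: A); split; first by split; rewrite ?finset.setUCr ?finset.setICr.
have [m0|m0] := posnP (num_edges D); first by rewrite m0 mulr0 ler0n.
rewrite -ler_pdivlMr ?ltr0n //; apply: ge_sup => // c hc.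
rewrite ler_pdivlMr ?ltr0n //.
have [V1 [V2 [[hU hI] h]]] := hc D hD.
apply: le_trans h _; rewrite ler_nat.
have -> : V2 = ~: V1.
  apply/finset.setP => x; move/finset.setP/(_ x): hU; move/finset.setP/(_ x): hI.
  by rewrite !inE; do 2!case: (_ \in _).
exact: hA.
Qed.

(* Main.v *)
Require Import Defs.
From mathcomp Require Import all_boot all_order all_algebra.
From mathcomp Require Import boolp classical_sets reals.
From mathcomp Require Import zify ring lra.
Import Order.TTheory GRing.Theory Num.Theory.
Local Open Scope ring_scope.

(** Take K disjoint copies of the rotational tournament on Z/(2d-1), in which
    every in- and outdegree is d-1, and an apex that receives an edge from every
    vertex and sends d edges to the first copy.  All outdegrees are at least d,
    and m >= K d (2d-1).  Consider the edges that leave the side of the apex.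
    At most d of them start at the apex.  The others lie inside the copies, and
    since a copy is Eulerian they are half of an undirected cut of the complete
    graph K_{2d-1}, hence at most d(d-1)/2 in each copy.  Letting K tend to
    infinity gives the ratio (d-1)/(2(2d-1)). *)

Section EulerianCut.
Local Open Scope nat_scope.

(** Adding the edges inside [A] turns the two sides into the total outdegree and the total indegree
    of [A], both equal to [e * #|A|]. *)
Lemma regular_cut_sym (T : finType) (r : rel T) (e : nat) (A : {set T}) :
  (forall a, \sum_b (r a b : nat) = e) ->
  (forall b, \sum_a (r a b : nat) = e) ->
  \sum_(a in A) \sum_(b in ~: A) (r a b : nat) =
  \sum_(a in A) \sum_(b in ~: A) (r b a : nat).
Proof.
move=> hout hin.
apply: (@addnI (\sum_(a in A) \sum_(b in A) (r a b : nat))).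
rewrite {2}exchange_big /= -!big_split /=; apply: eq_bigr => a _.
have split_sum F : \sum_(b in A) F b + \sum_(b in ~: A) F b = \sum_b F b.
  by rewrite [RHS](bigID (mem A)); congr (_ + _); apply: eq_bigl => b; rewrite inE.
by rewrite !split_sum hout hin.
Qed.

(** By symmetry, twice the directed cut counts the edges across the cut in both directions.
    Asymmetry leaves at most one per pair, so at most [#|A| * #|~: A|]. *)
Lemma regular_tournament_cut (T : finType) (r : rel T) (e : nat) (A : {set T}) :
  #|T| = e.*2.+1 ->
  (forall a b, r a b -> ~~ r b a) ->
  (forall a, \sum_b (r a b : nat) = e) ->
  (forall b, \sum_a (r a b : nat) = e) ->
  (\sum_(a in A) \sum_(b in ~: A) (r a b : nat)).*2 <= e * e.+1.
Proof.
move=> cT asym hout hin; rewrite -addnn {2}(regular_cut_sym _ _ _ _ hout hin).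
rewrite -big_split; apply: (@leq_trans (#|A| * #|~: A|)); last first.
  have := cardsC A; rewrite cT; move: #|A| #|~: A| => x y xy.
  (* With [x + y = 2e + 1] and [k] the gap from the smaller part up to [e], the product is
     [(e - k)(e + 1 + k) = e(e + 1) - k(k + 1)]. *)
  have [?|?] := leqP x e; have [k ?] : exists k, e = minn x y + k.
  - by exists (e - minn x y); lia.
  - by nia.
  - by exists (e - minn x y); lia.
  - by nia.
rewrite -[leqRHS]sum_nat_const; apply: leq_sum => a _.
rewrite -big_split -sum1_card; apply: leq_sum => b _ /=.
by have := asym a b; case: (r a b) (r b a) => [] [] // /(_ isT).
Qed.

End EulerianCut.

Section RotationalTournament.
Variable e : nat.
Local Notation T := 'I_(e.*2).+1.

(** Here [e] is d - 1, and [b - a] is taken in Z/(2e+1). *)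
Definition rot_edge (a b : T) : bool := (0 < val (b - a)%R <= e)%N.

Lemma rot_edge_irr (a : T) : rot_edge a a = false.
Proof. by rewrite /rot_edge subrr. Qed.

Lemma rot_edge_asym (a b : T) : rot_edge a b -> ~~ rot_edge b a.
Proof.
rewrite /rot_edge -(opprB b a); set x := b - a => /andP[x0 xe].
have -> : val (- x) = ((e.*2).+1 - x)%N.
  by rewrite /= modn_small //; move: x0 => /=; lia.
by move: x0 xe => /=; lia.
Qed.

Lemma sum_rot_step : (\sum_(x : T) (0 < val x <= e : nat))%N = e.
Proof.
(* The residues are cut into 0, then 1 to [e], then [e + 1] to [2e]; only the middle block
   counts. *)
rewrite big_ord_recl /= add0n -addnn big_split_ord /=.
rewrite (eq_bigr (fun=> 1%N)) => [|i _]; last by case: i => i /= ->.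
rewrite sum_nat_const card_ord muln1 big1 ?addn0 // => i _ /=.
by rewrite /bump /=; lia.
Qed.

Lemma sum_rot_out (a : T) : (\sum_b (rot_edge a b : nat))%N = e.
Proof.
rewrite (reindex_inj (addrI a)) /= -[RHS]sum_rot_step.
by apply: eq_bigr => x _; rewrite /rot_edge addrC addKr.
Qed.

Lemma sum_rot_in (b : T) : (\sum_a (rot_edge a b : nat))%N = e.
Proof.
rewrite (reindex_inj (@subrI _ b)) /= -[RHS]sum_rot_step.
by apply: eq_bigr => x _; rewrite /rot_edge subKr.
Qed.

Variable K : nat.
Local Notation V := (unit + 'I_K.+1 * T)%type.

(** The apex is [inl tt]. Taking [K.+1] copies ensures that copy [ord0] exists; its elements 0 to
    [e] are the d out-neighbors of the apex. *)
Definition apex_edge (u v : V) : bool :=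
  match u, v with
  | inl _, inl _ => false
  | inl _, inr p => (p.1 == ord0) && (val p.2 <= e)%N
  | inr _, inl _ => true
  | inr p, inr q => (p.1 == q.1) && rot_edge p.2 q.2
  end.

Lemma apex_edge_irr : irreflexive apex_edge.
Proof. by case=> [[]|[i a]] //=; rewrite rot_edge_irr andbF. Qed.

Definition apex_graph : digraph := @Digraph V apex_edge apex_edge_irr.

End RotationalTournament.

Arguments rot_edge {e} a b.

Section Counting.
Local Open Scope nat_scope.

Lemma outdegree_sum (D : digraph) (v : D) :
  outdegree v = \sum_w (edge v w : nat).
Proof. by rewrite /outdegree cardsE -sum1_card big_mkcond. Qed.

Lemma num_edges_sum (D : digraph) : num_edges D = \sum_(v : D) outdegree v.
Proof.
under eq_bigr do rewrite outdegree_sum.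
by rewrite pair_big /= /num_edges cardsE -sum1_card big_mkcond.
Qed.

Lemma edges_between_sum (D : digraph) (X Y : {set D}) :
  edges_between X Y = \sum_(v in X) \sum_(w in Y) (edge v w : nat).
Proof.
rewrite pair_big /= /edges_between cardsE -sum1_card big_mkcond /=.
rewrite [RHS]big_mkcond; apply: eq_bigr => p _.
by rewrite unfold_in; case: (p.1 \in X); case: (p.2 \in Y); case: (edge p.1 p.2).
Qed.

End Counting.

Section ApexGraph.
Local Open Scope nat_scope.
Variables e K : nat.
Local Notation G := (apex_graph e K).

Lemma apex_outdegree_apex : outdegree (inl tt : G) = e.+1.
Proof.
rewrite outdegree_sum big_sumType /= big1 // add0n.
rewrite -(pair_bigA _ (fun i a => ((i == ord0) && (val a <= e) : nat))) /=.
rewrite (bigD1 ord0) //= addnC big1 ?add0n => [|i /negPf ->]; last exact: big1.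
rewrite big_ord_recl /= -[in RHS]add1n; congr (_ + _).
rewrite -[RHS]sum_rot_step [RHS]big_ord_recl /= add0n.
by apply: eq_bigr.
Qed.

Lemma apex_outdegree_copy (i : 'I_K.+1) (a : 'I_(e.*2).+1) :
  outdegree (inr (i, a) : G) = e.+1.
Proof.
rewrite outdegree_sum big_sumType /= sum1_card card_unit add1n; congr _.+1.
rewrite -(pair_bigA _ (fun j b => ((i == j) && rot_edge a b : nat))) /=.
rewrite (bigD1 i) //= eqxx addnC big1 ?add0n ?sum_rot_out // => j.
by rewrite eq_sym => /negPf ->; exact: big1.
Qed.

Lemma apex_outdegree (v : G) : outdegree v = e.+1.
Proof.
by case: v => [[]|[i a]]; [exact: apex_outdegree_apex|exact: apex_outdegree_copy].
Qed.

Lemma card_apex_graph : #|G| = (K.+1 * (e.*2).+1).+1.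
Proof. by rewrite card_sum card_unit card_prod !card_ord. Qed.

Lemma apex_min_outdegree : e.+1 <= min_outdegree G.
Proof.
apply/leq_min_outdegree => //; rewrite card_apex_graph; split=> // v.
by rewrite apex_outdegree.
Qed.

Lemma num_edges_apex : num_edges G = e.+1 * (K.+1 * (e.*2).+1).+1.
Proof.
rewrite num_edges_sum; under eq_bigr do rewrite apex_outdegree.
by rewrite sum_nat_const card_apex_graph mulnC.
Qed.

Lemma apex_cut (X Y : {set G}) : bipartition X Y -> inl tt \in X ->
  (edges_between X Y).*2 <= K.+1 * (e * e.+1) + e.+1.*2.
Proof.
move=> [hU hI] aX.
have Yv (v : G) : (v \in Y) = (v \notin X).
  move/setP/(_ v): hU; move/setP/(_ v): hI.
  by rewrite !inE; do 2!case: (_ \in _).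
rewrite edges_between_sum big_sumType /= doubleD addnC; apply: leq_add.
  (* [A i] is the trace of [X] on copy [i]. Edges into the apex stay out of the cut because the apex
     lies in [X], and no edge joins two copies, so each copy is bounded separately. *)
  pose A i := [set a | (inr (i, a) : G) \in X].
  rewrite [X in X.*2](_ : _ = \sum_i \sum_(a in A i) \sum_(b in ~: A i)
      (rot_edge a b : nat)); last first.
    rewrite [RHS]pair_big_dep /=; apply: eq_big => [[i a]|[i a] _] /=.
      by rewrite inE.
    rewrite big_sumType /= big1 ?add0n => [|[]]; last by rewrite Yv aX.
    transitivity (\sum_j \sum_b if (inr (j, b) : G) \in Y then
        ((i == j) && rot_edge a b : nat) else 0).
      by rewrite pair_bigA big_mkcond; apply: eq_bigr => -[].
    rewrite (bigD1 i) //= eqxx [X in _ + X]big1 ?addn0 => [|j].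
      by rewrite [RHS]big_mkcond; apply: eq_bigr => b _; rewrite !inE Yv.
    by rewrite eq_sym => /negPf ->; apply: big1 => b _; case: ifP.
  rewrite -muln2 big_distrl -[in leqRHS](card_ord K.+1) -sum_nat_const /=.
  apply: leq_sum => i _; rewrite muln2.
  apply: regular_tournament_cut; rewrite ?card_ord //.
  - exact: rot_edge_asym.
  - exact: sum_rot_out.
  - exact: sum_rot_in.
(* The apex contributes at most its whole outdegree. *)
rewrite leq_double -apex_outdegree_apex outdegree_sum.
rewrite (bigD1 tt) //= [X in _ + X]big1 ?addn0 => [|[] /andP[_]] //.
by rewrite [leqRHS](bigID (mem Y)) /= leq_addr.
Qed.

Lemma apex_minn (X Y : {set G}) : bipartition X Y ->
  (minn (edges_between X Y) (edges_between Y X)).*2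
    <= K.+1 * (e * e.+1) + e.+1.*2.
Proof.
(* The minimum is bounded by the direction that leaves the side of the apex. *)
move=> hXY; have [aX|aX] := boolP ((inl tt : G) \in X).
  by apply: leq_trans (apex_cut _ _ hXY aX); rewrite leq_double geq_minl.
have hYX : bipartition Y X.
  by case: hXY; rewrite /bipartition finset.setUC finset.setIC.
have aY : (inl tt : G) \in Y.
  by case: hXY => /setP/(_ (inl tt)); rewrite !inE (negPf aX).
by apply: leq_trans (apex_cut _ _ hYX aY); rewrite leq_double geq_minr.
Qed.

End ApexGraph.

Theorem mainTheorem3 (R : realType) (d : nat) (hd : (2 <= d)%N) (c_d : R)
  (hc : max_admissible d c_d) :
  c_d <= (d%:R - 1) / (2 * (2 * d%:R - 1)).
Proof.
case: d hd hc => // e _ [hc _].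
have e0 : 0 <= e%:R :> R by exact: ler0n.
have dE : e.+1%:R = e%:R + 1 :> R by rewrite natr1.
have nE : (e.*2).+1%:R = 2 * e%:R + 1 :> R by rewrite -natr1 -mul2n natrM.
rewrite ler_pdivlMr dE ?addrK; last by lra.
have [c0|c0] := ltP c_d 0; first by nra.
rewrite leNgt; apply/negP => hlt.
(* [q] is the assumed excess of [c_d] over the bound, scaled by 2(2d-1). *)
set q : R := c_d * (2 * (2 * (e%:R + 1) - 1)) - e%:R.
have q0 : 0 < q by rewrite /q; lra.
(* The 2 is the apex term [e.+1.*2] of the cut bound divided by the common factor [e + 1]. *)
pose K := Num.truncn (2 / q).
have hK : 2 < K.+1%:R * q by rewrite -ltr_pdivrMr // truncnS_gt.
have [X [Y [hXY hm]]] := hc _ (apex_min_outdegree e K).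
have := apex_minn _ _ _ _ hXY; rewrite -(ler_nat R) -muln2 -muln2 natrM => hcut.
move: hm; rewrite num_edges_apex => hm.
set m : R := (minn _ _)%:R in hm hcut.
have {hcut} hcut : m * 2 <= (e%:R + 1) * (K.+1%:R * e%:R + 2).
  by apply: le_trans hcut _; rewrite natrD !natrM dE; lra.
(* The [e + 1] edges leaving the apex are dropped from the edge count, which is sound since [c_d] is
   nonnegative. *)
have {}hm : c_d * ((e%:R + 1) * (K.+1%:R * (2 * e%:R + 1))) <= m.
  apply: le_trans hm; apply: ler_wpM2l => //.
  by rewrite natrM dE -[(_ * _).+1%:R]natr1 natrM nE; nra.
(* Twice [hm] combined with [hcut]; cancelling [e + 1] contradicts [hK]. *)
have : (e%:R + 1) * (K.+1%:R * q) <= (e%:R + 1) * 2.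
  by rewrite /q; lra.
by rewrite ler_pM2l; lra.
Qed.
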